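(* Let $n\ge 2$ be an integer, let $G$ be a compact group, let $X$ be a linear space, and let $P\colon \mathcal{T}(G)\to X$ be an orthogonally additive $n$-homogeneous polynomial, where $\mathcal{T}(G)$ is regarded as an algebra under convolution. Then there exists a unique linear map $\Phi\colon\mathcal{T}(G)\to X$ such that $$P(f)=\Phi\left(f^{*n}\right)$$ for each $f\in\mathcal{T}(G)$. Further, if $\varphi\colon\mathcal{T}(G)^{n}\to X$ is the symmetric $n$-linear map associated with $P$, then $$\Phi(f)=\sum_{[\pi]\in\widehat{G}}\varphi\left(d_\pi f\ast\chi_\pi,\,d_\pi\chi_\pi,\dotsc,d_\pi\chi_\pi\right)$$ for each $f\in\mathcal{T}(G)$ (the term $f\ast\chi_\pi$ being $0$ for all but finitely many $[\pi]\in\widehat{G}$).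
   Context: All algebras and linear spaces are complex. A map $P\colon E\to Y$ between linear spaces is an $n$-homogeneous polynomial if there is an $n$-linear map $\varphi\colon E^n\to Y$ with $P(x)=\varphi(x,\dotsc,x)$ for all $x\in E$; there is a unique symmetric such $\varphi$, called the symmetric $n$-linear map associated with $P$. A map $P\colon A\to Y$ from an algebra $A$ to a linear space $Y$ is orthogonally additive if $P(a+b)=P(a)+P(b)$ whenever $a,b\in A$ satisfy $ab=ba=0$. The Haar measure of the compact group $G$ is normalized, and $\ast$ denotes convolution; $f^{*n}$ is the $n$-fold convolution product $f\ast\dotsb\ast f$. $\widehat{G}$ is the set of unitary equivalence classes $[\pi]$ of irreducible unitary representations $\pi$ of $G$; $\pi$ acts on the (finite-dimensional) Hilbert space $H_\pi$, $d_\pi=\dim H_\pi$, and $\chi_\pi(t)=\operatorname{trace}(\pi(t))$ for $t\in G$. $\mathcal{T}_\pi(G)$ is the linear subspace of $C(G)$ generated by the functions $t\mapsto\langle\pi(t)u\,|\,v\rangle$ with $u,v\in H_\pi$, and $\mathcal{T}(G)$ (the trigonometric polynomials on $G$) is the linear span of all the $\mathcal{T}_\pi(G)$, $[\pi]\in\widehat{G}$. Both $\chi_\pi$ and $\mathcal{T}_\pi(G)$ depend only on $[\pi]$. $\mathcal{T}(G)$ is a two-sided ideal of the convolution algebra $L^1(G)$. *)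

(* Defs.v *)
From HB Require Import structures.
From mathcomp Require Import all_boot all_order all_algebra perm.
From mathcomp Require Import sesquilinear spectral generic_quotient.
From mathcomp Require Import all_classical all_reals all_analysis measurable_realfun.
From mathcomp Require Import complex.

Set Implicit Arguments.
Unset Strict Implicit.
Unset Printing Implicit Defensive.

Import Order.TTheory GRing.Theory Num.Theory.
Import numFieldNormedType.Exports.

Local Open Scope classical_set_scope.
Local Open Scope ring_scope.
Local Open Scope quotient_scope.
Local Open Scope sesquilinear_scope.
Local Open Scope complex_scope.

(* The base point required by [PointedTopological] plays no role: it is only
   there because [g_sigma_algebraType] is defined over pointed types. *)
HB.mixin Record isCompactGroup G of Group G & PointedTopological G := {
  mulg_continuous : continuous (fun x : G * G => (x.1 * x.2)%g);
  invg_continuous : continuous (fun x : G => (x^-1)%g);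
  compact_group : compact [set: G];
  hausdorff_group : hausdorff_space G;
}.

#[short(type="compactGroupType")]
HB.structure Definition CompactGroup :=
  {G of Group G & PointedTopological G & isCompactGroup G}.

Section multilinear.
Variables (K : pzRingType) (E Y : lmodType K) (n : nat).

Definition multilinear (phi : ('I_n -> E) -> Y) : Prop :=
  forall (x : 'I_n -> E) (i : 'I_n) (a : K) (u v : E),
    phi (dfwith x i (a *: u + v)) =
    a *: phi (dfwith x i u) + phi (dfwith x i v).

Definition symmetric_map (phi : ('I_n -> E) -> Y) : Prop :=
  forall (s : 'S_n) (x : 'I_n -> E), phi (x \o s) = phi x.

Definition homogeneous_polynomial (P : E -> Y) : Prop :=
  exists2 phi : ('I_n -> E) -> Y,
    multilinear phi & forall x, P x = phi (fun=> x).

Definition associated_symmetric (P : E -> Y) (phi : ('I_n -> E) -> Y) : Prop :=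
  [/\ multilinear phi, symmetric_map phi & forall x, P x = phi (fun=> x)].

End multilinear.

Definition orthogonally_additive (A Y : zmodType) (mul : A -> A -> A)
    (P : A -> Y) : Prop :=
  forall a b, mul a b = 0 -> mul b a = 0 -> P (a + b) = P a + P b.

Section lin_span.
Variables (K : pzRingType) (V : lmodType K).

Definition lin_span (S : set V) : set V :=
  [set v | exists (m : nat) (a : 'I_m -> K) (x : 'I_m -> V),
    (forall i, S (x i)) /\ v = \sum_i a i *: x i].

Lemma lin_span_mem (S : set V) v : S v -> lin_span S v.
Proof.
by move=> Sv; exists 1%N, (fun=> 1), (fun=> v); rewrite big_ord1 scale1r.
Qed.

Lemma lin_span0 (S : set V) : lin_span S 0.
Proof.
exists 0%N, (fun=> 0), (fun=> 0); rewrite big_ord0.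
by split=> // -[].
Qed.

Lemma lin_spanD (S : set V) u v :
  lin_span S u -> lin_span S v -> lin_span S (u + v).
Proof.
move=> [m [a [x [Sx ->]]]] [m' [a' [x' [Sx' ->]]]].
exists (m + m')%N,
  (fun i => match fintype.split i with inl j => a j | inr j => a' j end),
  (fun i => match fintype.split i with inl j => x j | inr j => x' j end).
split=> [i|]; first by case: fintype.splitP.
rewrite big_split_ord /=; congr (_ + _); apply: eq_bigr => i _.
  by rewrite (unsplitK (inl i)).
by rewrite (unsplitK (inr i)).
Qed.

Lemma lin_spanZ (S : set V) a v : lin_span S v -> lin_span S (a *: v).
Proof.
move=> [m [b [x [Sx ->]]]]; exists m, (fun i => a * b i), x; split=> //.
by rewrite scaler_sumr; apply: eq_bigr => i _; rewrite scalerA.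
Qed.

Lemma lin_span_sum (S : set V) I (r : seq I) (P : pred I) (F : I -> V) :
  (forall i, P i -> lin_span S (F i)) ->
  lin_span S (\sum_(i <- r | P i) F i).
Proof.
by apply: (big_ind (lin_span S)); [exact: lin_span0 | exact: lin_spanD].
Qed.

Lemma lin_spanS (S T : set V) :
  S `<=` T -> lin_span S `<=` lin_span T.
Proof. by move=> ST v [m [a [x [Sx ->]]]]; exists m, a, x; split=> // i; exact/ST. Qed.

End lin_span.

Section unitary_representations.
Variables (R : realType) (G : compactGroupType).

Definition inner d (u v : 'cV[R[i]]_d) : R[i] := (v ^t* *m u) 0 0.

(* Irreducible unitary representations of a compact group are
   finite-dimensional, so up to unitary equivalence H_pi is C^d with its
   standard inner product; operators act on column vectors. *)
Record irrep := Irrep {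
  rdim : nat;
  rmx :> G -> 'M[R[i]]_rdim;
  rmxM : forall s t, rmx (s * t)%g = rmx s *m rmx t;
  rmx_unitary : forall t, rmx t \is unitarymx;
  rmx_continuous : continuous (rmx : G -> 'M[R[i]^o]_rdim);
  rdim_gt0 : (0 < rdim)%N;
  rmx_irreducible : forall W : {vspace 'cV[R[i]]_rdim},
    (forall t u, u \in W -> rmx t *m u \in W) -> W = 0%VS \/ W = fullv
}.

HB.instance Definition _ := gen_eqMixin irrep.
HB.instance Definition _ := gen_choiceMixin irrep.

Definition intertwiner (p q : irrep) (U : 'M[R[i]]_(rdim q, rdim p)) : Prop :=
  forall t, U *m p t = q t *m U.

(* [U] is rectangular, hence both conditions: U U^* = 1 and U^* U = 1. *)
Definition unitary_equiv (p q : irrep) : Prop :=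
  exists U : 'M[R[i]]_(rdim q, rdim p),
    [/\ U \is unitarymx, U ^t* \is unitarymx & intertwiner U].

Definition unitary_equivb (p q : irrep) : bool := `[< unitary_equiv p q >].

Lemma trmxC_involutive m n (U : 'M[R[i]]_(m, n)) : (U ^t*) ^t* = U.
Proof. by apply/matrixP => i j; rewrite !mxE conjCK. Qed.

Lemma unitary_equiv_refl : reflexive unitary_equivb.
Proof.
move=> p; apply/asboolP; exists 1%:M.
have U1 : (1%:M : 'M[R[i]]_(rdim p)) \is unitarymx.
  by apply/unitarymxP; rewrite trmx1 map_mx1 mulmx1.
by split=> [//||t]; rewrite ?trmxC_unitary ?mul1mx ?mulmx1.
Qed.

Lemma unitary_equiv_sym : symmetric unitary_equivb.
Proof.
suff H p q : unitary_equiv p q -> unitary_equiv q p.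
  by move=> p q; apply/asboolP/asboolP; exact: H.
move=> [U [U1 U2 UI]]; exists (U ^t*); split=> [//||t].
  by rewrite trmxC_involutive.
have UU : U ^t* *m U = 1%:M by have /unitarymxP := U2; rewrite trmxC_involutive.
have UU' : U *m U ^t* = 1%:M by apply/unitarymxP.
by rewrite -[LHS]mulmx1 -UU' !mulmxA -(mulmxA _ (q t)) -UI !mulmxA UU mul1mx.
Qed.

Lemma unitary_equiv_trans : transitive unitary_equivb.
Proof.
move=> q p r /asboolP[U [U1 U2 UI]] /asboolP[V [V1 V2 VI]]; apply/asboolP.
exists (V *m U); split=> [||t].
- exact: mul_unitarymx.
- by rewrite trmx_mul map_mxM; exact: mul_unitarymx.
- by rewrite -mulmxA UI mulmxA VI mulmxA.
Qed.

Canonical unitary_equiv_rel :=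
  EquivRel unitary_equivb unitary_equiv_refl unitary_equiv_sym
    unitary_equiv_trans.

Definition unitary_dual := {eq_quot unitary_equivb}.
HB.instance Definition _ := Choice.on unitary_dual.

Definition coef (p : irrep) (u v : 'cV[R[i]]_(rdim p)) : G -> R[i]^o :=
  fun t => inner (p t *m u) v.
Arguments coef : clear implicits.

Definition character (p : irrep) : G -> R[i]^o := fun t => \tr (p t).

Definition coef_space (p : irrep) : set (G -> R[i]^o) :=
  lin_span [set f | exists u v, f = coef p u v].

Definition trigpoly : {pred G -> R[i]^o} :=
  [pred f | `[< lin_span (\bigcup_p coef_space p) f >] ].

Lemma trigpolyP f : reflect (lin_span (\bigcup_p coef_space p) f) (f \in trigpoly).
Proof. exact: asboolP. Qed.

Lemma trigpoly_submod : submod_closed trigpoly.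
Proof.
split=> [|a f g /trigpolyP Tf /trigpolyP Tg]; apply/trigpolyP.
  exact: lin_span0.
exact/lin_spanD/Tg/lin_spanZ.
Qed.

HB.instance Definition _ :=
  GRing.isSubmodClosed.Build R[i] (G -> R[i]^o) trigpoly trigpoly_submod.

Record trigPoly := TrigPoly {
  trigPoly_fun :> G -> R[i]^o;
  trigPolyP : trigPoly_fun \in trigpoly
}.

HB.instance Definition _ := [isSub for trigPoly_fun].
HB.instance Definition _ := [Choice of trigPoly by <:].
HB.instance Definition _ := [SubChoice_isSubLmodule of trigPoly by <:].

Let continuous_part (part : {additive R[i] -> R}) :
  (forall z, part z ^+ 2 <= complex.Re z ^+ 2 + complex.Im z ^+ 2) ->
  continuous (part : R[i]^o -> R).
Proof.
move=> le_part z; apply/(@cvgrPdist_lt _ _ _ _ (nbhs_filter (z : R[i]^o))) => e e0.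
exists e%:C; rewrite /= ?ltcR// => w zw; rewrite /= -ltcR.
by apply: le_lt_trans zw; rewrite normc_def lecR -raddfB -sqrtr_sqr ler_wsqrtr.
Qed.

Lemma continuous_Re : continuous (@complex.Re R : R[i]^o -> R).
Proof. by apply: (continuous_part (part := @complex.Re R)) => z; rewrite lerDl sqr_ge0. Qed.

Lemma continuous_Im : continuous (@complex.Im R : R[i]^o -> R).
Proof. by apply: (continuous_part (part := @complex.Im R)) => z; rewrite lerDr sqr_ge0. Qed.

Lemma continuous_sumc I (r : seq I) (F : I -> G -> R[i]^o) :
  (forall i, continuous (F i)) -> continuous (fun x => \sum_(i <- r) F i x).
Proof.
move=> cF; elim: r => [|i r IHr].
  by under eq_fun do rewrite big_nil; move=> x; exact: cvg_cst.
under eq_fun do rewrite big_cons.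
by move=> x; apply: continuousD; [exact: cF|exact: IHr].
Qed.

Lemma continuous_coef (p : irrep) u v : continuous (coef p u v).
Proof.
have -> : coef p u v = (fun t => \sum_i \sum_j
    p t i j * ((v ^t* ) 0 i * u j 0 )).
  apply/funext => t; rewrite /coef /inner mxE; apply: eq_bigr => i _.
  rewrite [X in _ * X]mxE mulr_sumr; apply: eq_bigr => j _.
  by rewrite mulrCA.
apply: continuous_sumc => i; apply: continuous_sumc => j x.
apply: continuousM; last exact: cvg_cst.
apply: (@continuous_comp _ _ _ (rmx p : G -> 'M[R[i]^o]_(rdim p))
  (fun M : 'M[R[i]^o]_(rdim p) => M i j : R[i]^o)).
  exact: rmx_continuous.
exact: coord_continuous.
Qed.

Lemma lin_span_trigpolyE (f : G -> R[i]^o) : f \in trigpoly ->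
  lin_span [set g | exists (p : irrep) (u v : 'cV_(rdim p)), g = coef p u v] f.
Proof.
move=> /trigpolyP[m [a [x [Sx ->]]]]; apply: lin_span_sum => i _.
apply: lin_spanZ; have [p _] := Sx i; apply: lin_spanS.
by move=> g [u [v ->]]; exists p, u, v.
Qed.

Lemma coef_trigpoly (p : irrep) u v : coef p u v \in trigpoly.
Proof.
apply/trigpolyP; apply: lin_span_mem; exists p => //; apply: lin_span_mem.
by exists u, v.
Qed.

Lemma trigpoly_continuous (f : G -> R[i]^o) : f \in trigpoly -> continuous f.
Proof.
move=> /lin_span_trigpolyE[m [a [x [Sx ->]]]].
rewrite fct_sumE; apply: continuous_sumc => i; have [p [u [v ->]]] := Sx i.
move=> t; apply: continuousM; first exact: cvg_cst.
exact: continuous_coef.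
Qed.

Lemma continuous_mulc (f g : G -> R[i]^o) : continuous f -> continuous g ->
  continuous (fun x => f x * g x).
Proof.
by move=> cf cg x; apply: (@continuousM R[i] G f g x); [exact: cf|exact: cg].
Qed.

Lemma inner_delta d (w : 'cV[R[i]]_d) i : inner w (delta_mx i 0) = w i 0.
Proof.
rewrite /inner mxE (bigD1 i) //= big1 ?addr0 => [|j ji].
  by rewrite !mxE !eqxx /= conjC1 mul1r.
by rewrite !mxE (negPf ji) /= conjC0 mul0r.
Qed.

Lemma char_trigpoly (p : irrep) : character p \in trigpoly.
Proof.
have -> : character p = \sum_i coef p (delta_mx i 0) (delta_mx i 0).
  apply/funext => t; rewrite fct_sumE; apply: eq_bigr => i _.
  by rewrite /coef inner_delta -colE mxE.
by apply: rpred_sum => i _; exact: coef_trigpoly.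
Qed.

Definition trig_char (p : irrep) : trigPoly := TrigPoly (char_trigpoly p).

Lemma unitary_equiv_rdim (p q : irrep) : unitary_equiv p q -> rdim p = rdim q.
Proof.
move=> [U [/mxrank_unitary rU /mxrank_unitary rUt _]].
apply/eqP; rewrite eqn_leq -{1}rUt rank_leq_col /=.
by rewrite -rU rank_leq_col.
Qed.

Lemma unitary_equiv_char (p q : irrep) : unitary_equiv p q -> character p = character q.
Proof.
move=> [U [/unitarymxP U1 /unitarymxP U2 UI]]; apply/funext => t.
rewrite trmxC_involutive in U2.
by rewrite /character -[q t]mulmx1 -U1 mulmxA -UI mxtrace_mulC mulmxA U2 mul1mx.
Qed.

(* By [unitary_equiv_rdim] and [unitary_equiv_char], the degree and the character
   do not depend on the representative chosen by [repr]. *)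
Definition dual_dim (c : unitary_dual) : nat := rdim (repr c).
Definition dual_char (c : unitary_dual) : trigPoly := trig_char (repr c).

End unitary_representations.

Arguments coef {R G} p u v _.

Notation borel G := (g_sigma_algebraType (@open G)).

Section haar.
Variables (R : realType) (G : compactGroupType).
Variable mu : probability (borel G) R.

Definition translation_invariant : Prop :=
  forall (s : G) (A : set (borel G)), measurable A ->
    mu [set (s * x)%g | x in A] = mu A.

Definition regular_measure : Prop :=
  forall A : set (borel G), measurable A ->
    mu A = ereal_inf [set mu U | U in [set U : set G | open U /\ A `<=` U]] /\
    mu A = ereal_sup [set mu K | K in [set K : set G | compact K /\ K `<=` A]].

Definition haar_measure : Prop := translation_invariant /\ regular_measure.

Definition cintegral (f : G -> R[i]) : R[i] :=
  (\int[mu]_x complex.Re (f x)) +i* (\int[mu]_x complex.Im (f x)).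

Definition convolution (f g : G -> R[i]^o) : G -> R[i]^o :=
  fun t => cintegral (fun s => f s * g (s^-1 * t)%g).

Let cintegrable (f : G -> R[i]) :=
  mu.-integrable [set: borel G] (EFin \o (fun x => complex.Re (f x))) /\
  mu.-integrable [set: borel G] (EFin \o (fun x => complex.Im (f x))).

Lemma continuous_integrable (h : G -> R) : continuous h ->
  mu.-integrable [set: borel G] (EFin \o h).
Proof.
move=> ch; apply: measurable_bounded_integrable => //.
- by rewrite (le_lt_trans (probability_le1 mu measurableT)) ?ltry.
- apply: (measurability _ (RGenOpens.measurableE R)).
  move=> _ [_ [a [b ->] <-]]; rewrite setTI; apply: sub_sigma_algebra.
  by move/continuousP: ch; apply; exact: interval_open.
- have ch' : {within [set: G], continuous h} by exact: continuous_subspaceT.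
  have /compact_bounded[M [_ mrt]] :=
    continuous_compact ch' (@compact_group G).
  by exists M; split; rewrite ?num_real // => ? ? ? ?; exact: mrt.
Qed.

Lemma continuous_cintegrable (f : G -> R[i]^o) : continuous f -> cintegrable f.
Proof.
move=> cf; split; apply: continuous_integrable => x;
  apply: continuous_comp; [exact: cf|exact: continuous_Re|exact: cf|exact: continuous_Im].
Qed.

Lemma cintegralD (f g : G -> R[i]^o) : continuous f -> continuous g ->
  cintegral (fun x => f x + g x) = cintegral f + cintegral g.
Proof.
move=> /continuous_cintegrable[f1 f2] /continuous_cintegrable[g1 g2].
rewrite /cintegral.
have -> : (fun x => complex.Re (f x + g x)) =
  (fun x => complex.Re (f x) + complex.Re (g x)).
  by apply/funext => x; case: (f x) (g x) => [? ?] [? ?].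
have -> : (fun x => complex.Im (f x + g x)) =
  (fun x => complex.Im (f x) + complex.Im (g x)).
  by apply/funext => x; case: (f x) (g x) => [? ?] [? ?].
by rewrite !RintegralD.
Qed.

Lemma cintegralZ (a : R[i]) (f : G -> R[i]^o) : continuous f ->
  cintegral (fun x => f x * a) = cintegral f * a.
Proof.
move=> /continuous_cintegrable[f1 f2]; case: a => a b; rewrite /cintegral.
have iZ c (h : G -> R) : mu.-integrable [set: borel G] (EFin \o h) ->
    mu.-integrable [set: borel G] (EFin \o (fun x => h x * c)).
  move=> ih; rewrite [X in integrable _ _ X](_ : _ = (fun x => c%:E * (EFin \o h) x)%E).
    exact: integrableZl.
  by apply/funext => x /=; rewrite -EFinM mulrC.
have -> : (fun x => complex.Re (f x * (a +i* b))) =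
  (fun x => complex.Re (f x) * a - complex.Im (f x) * b).
  by apply/funext => x; case: (f x) => [? ?].
have -> : (fun x => complex.Im (f x * (a +i* b))) =
  (fun x => complex.Re (f x) * b + complex.Im (f x) * a).
  by apply/funext => x; case: (f x) => [? ?].
by rewrite RintegralB ?RintegralD ?RintegralZr //; exact: iZ.
Qed.

Lemma cintegral0 : cintegral (fun=> 0) = 0.
Proof. by rewrite /cintegral !Rintegral_cst //= !mul0r. Qed.

Lemma cintegral_sum I (r : seq I) (F : I -> G -> R[i]^o) :
  (forall i, continuous (F i)) ->
  cintegral (fun x => \sum_(i <- r) F i x) = \sum_(i <- r) cintegral (F i).
Proof.
move=> cF; elim: r => [|i r IHr].
  rewrite big_nil -[RHS]cintegral0.
  by congr cintegral; apply/funext => x; rewrite big_nil.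
rewrite big_cons -IHr -cintegralD//; last exact: continuous_sumc.
by congr cintegral; apply/funext => x; rewrite big_cons.
Qed.

Lemma convolution_coef (f : G -> R[i]^o) (p : irrep R G) u v :
  continuous f -> convolution f (coef p u v) =
    \sum_i cintegral (fun s => f s * coef p (delta_mx i 0) v (s^-1)%g) *:
      coef p u (delta_mx i 0).
Proof.
move=> cf; apply/funext => t; rewrite fct_sumE /convolution.
have coefE s : coef p u v (s^-1 * t)%g =
    \sum_i coef p (delta_mx i 0) v (s^-1)%g * coef p u (delta_mx i 0) t.
  rewrite /coef {1}/inner rmxM -(mulmxA (p _)) [v ^t* *m _]mulmxA mxE.
  apply: eq_bigr => i _; rewrite inner_delta; congr (_ * _).
  by rewrite /inner mulmxA -colE [RHS]mxE.
transitivity (cintegral (fun s => \sum_i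
    f s * coef p (delta_mx i 0) v (s^-1)%g * coef p u (delta_mx i 0) t)).
  congr cintegral; apply/funext => s.
  by rewrite coefE mulr_sumr; apply: eq_bigr => i _; rewrite mulrA.
have cF i : continuous (fun s => f s * coef p (delta_mx i 0) v (s^-1)%g).
  apply: continuous_mulc; first exact: cf.
  move=> s; apply: (@continuous_comp _ _ _ (fun s : G => (s^-1)%g)).
    exact: invg_continuous.
  exact: continuous_coef.
rewrite cintegral_sum.
  by apply: eq_bigr => i _; rewrite cintegralZ; [reflexivity|exact: cF].
by move=> i; apply: continuous_mulc; [exact: cF|move=> s; exact: cvg_cst].
Qed.

Lemma convolution_trigpoly f g : f \in @trigpoly R G -> g \in @trigpoly R G ->
  convolution f g \in @trigpoly R G.
Proof.
move=> /trigpoly_continuous cf /lin_span_trigpolyE[m [a [x [Sx ->]]]].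
have xT i : x i \in @trigpoly R G.
  by have [p [u [v ->]]] := Sx i; exact: coef_trigpoly.
have -> : convolution f (\sum_i a i *: x i) = \sum_i a i *: convolution f (x i).
  have cF i t : continuous (fun s => f s * x i (s^-1 * t)%g).
    apply: continuous_mulc; first exact: cf.
    move=> s; apply: (@continuous_comp _ _ _ (fun s : G => (s^-1 * t)%g)).
      apply: (@continuous_comp _ _ _ (fun s : G => (s^-1, t)%g)
        (fun z : G * G => (z.1 * z.2)%g)); last exact: mulg_continuous.
      by apply: cvg_pair; [exact: invg_continuous|exact: cvg_cst].
    exact: trigpoly_continuous.
  apply/funext => t; rewrite {1}/convolution !fct_sumE.
  transitivity (cintegral (fun s => \sum_i f s * x i (s^-1 * t)%g * a i)).
    congr cintegral; apply/funext => s; rewrite mulr_sumr.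
    by apply: eq_bigr => i _; rewrite mulrCA mulrC.
  rewrite cintegral_sum => [|i].
    by apply: eq_bigr => i _; rewrite cintegralZ; [exact: mulrC|exact: cF].
  by apply: continuous_mulc; [exact: cF|move=> s; exact: cvg_cst].
apply: rpred_sum => i _; apply: rpredZ; have [p [u [v ->]]] := Sx i.
by rewrite convolution_coef//; apply: rpred_sum => j _; apply/rpredZ/coef_trigpoly.
Qed.

Definition trig_conv (f g : trigPoly R G) : trigPoly R G :=
  TrigPoly (convolution_trigpoly (trigPolyP f) (trigPolyP g)).

(* The convolution algebra has in general no unit: exponent 0 is a junk value. *)
Definition conv_pow (n : nat) (f : trigPoly R G) : trigPoly R G :=
  iterop n trig_conv f 0.

End haar.

(* Main.v *)
Require Import Defs.
From HB Require Import structures.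
From mathcomp Require Import all_boot all_order all_algebra perm.
From mathcomp Require Import sesquilinear spectral generic_quotient.
From mathcomp Require Import all_classical all_reals all_analysis.
From mathcomp Require Import complex.

Set Implicit Arguments.
Unset Strict Implicit.
Unset Printing Implicit Defensive.

Import Order.TTheory GRing.Theory Num.Theory.

Local Open Scope ring_scope.
Local Open Scope complex_scope.

(** The proof transports the problem to matrix algebras by Fourier analysis.

    For an irreducible representation q of degree d and a d x d matrix B, let
    [synthesis q B] be the trigonometric polynomial t |-> d tr (B q(t)), and let
    [fourier mu q f] be the matrix of integrals of f(s) q(s^-1). Writing
    F_q for [fourier mu q], a computation under the integral sign gives
    f * synthesis q B = synthesis q (B F_q f) ([trig_conv_synthesis]), and left
    invariance of the Haar measure, through Schur's lemma, gives the orthogonality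
    relations: F_q inverts [synthesis q] and kills [synthesis p] for every p
    inequivalent to q. Hence a trigonometric polynomial is the finite sum of the
    syntheses of its Fourier coefficients over the dual ([fourier_inversion]), F_q
    turns convolution into the reversed matrix product ([fourier_conv]), and T(G)
    is a direct sum of matrix algebras in which the unit of the block of pi is
    d_pi chi_pi.

    Since distinct blocks are orthogonal, P is the sum of its restrictions to
    the blocks, and everything reduces to an orthogonally additive polynomial P
    on the algebra of d x d matrices, with associated symmetric map phi. There
    P A = phi (A^n, 1, ..., 1) ([orthogonally_additive_power_mx]). For an
    idempotent e, 1 + t e = (1 - e) + (1 + t) e is an orthogonal sum, so that
    P (1 + t e) = P (1 - e) + (1 + t)^n P e, and comparing the coefficients of t
    yields n phi (e, 1, ..., 1) = n P e. A Hermitian matrix is a combination of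
    orthogonal idempotents, which settles that case by orthogonal additivity and
    homogeneity. Finally a matrix is H + i N with H and N Hermitian: both sides
    at H + t N are polynomials in t that agree for every natural number t, hence
    have the same coefficients, hence agree at t = i.

    Conversely, if P f = Psi (f^n) for some linear Psi, the coefficient of t in
    P (1 + t A) = Psi ((1 + t A)^n) forces Psi A = phi (A, 1, ..., 1) on each
    block, for any symmetric phi associated with P
    ([power_factorization_unique]). This gives the uniqueness of Phi and, since
    Phi is such a Psi, the formula for it. *)

(** * Multilinear maps and homogeneous polynomials *)

Section multilinear_expansion.
Variables (K : pzRingType) (E Y : lmodType K) (n : nat).
Implicit Types (phi : ('I_n -> E) -> Y) (x y : 'I_n -> E).

Lemma dfwithE x i u j : dfwith x i u j = if j == i then u else x j.
Proof.
case: eqVneq => [->|ji]; first exact: dfwithin.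
by rewrite dfwithout // eq_sym.
Qed.

Lemma multilinearD phi x i u v : multilinear phi ->
  phi (dfwith x i (u + v)) = phi (dfwith x i u) + phi (dfwith x i v).
Proof. by move=> mphi; rewrite -[u]scale1r mphi !scale1r. Qed.

Lemma multilinear0 phi x i : multilinear phi -> phi (dfwith x i 0) = 0.
Proof.
move=> mphi; have := multilinearD x i 0 0 mphi.
by rewrite addr0 => /eqP; rewrite -subr_eq subrr eq_sym => /eqP.
Qed.

Lemma multilinearZ phi x i a u : multilinear phi ->
  phi (dfwith x i (a *: u)) = a *: phi (dfwith x i u).
Proof. by move=> mphi; rewrite -[_ *: u]addr0 mphi multilinear0 ?addr0. Qed.

(** Full expansion of a multilinear map at x + y, by induction on the list [r]
    of the slots already expanded: the slot added to [r] holds either x i, and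
    the subsets avoiding i remain, or y i, and the subsets containing i appear. *)
Lemma multilinear_expand_on phi (r : seq 'I_n) x y : multilinear phi -> uniq r ->
  phi (fun i => if i \in r then x i + y i else x i) =
  \sum_(S : {set 'I_n} | S \subset r) phi (fun i => if i \in S then y i else x i).
Proof.
move=> mphi; elim: r x => [|i r IHr] x /=.
  rewrite (big_pred1 finset.set0) => [_|S]; last first.
    apply/fintype.subsetP/eqP => [h|-> j]; last by rewrite !inE.
    by apply/finset.setP => j; apply/idP/idP => [/h|]; rewrite !inE.
  by congr phi; apply/funext => j; rewrite inE.
move=> /andP[ir ur].
pose z := fun j => if j \in r then x j + y j else x j.
have -> : (fun j => if j \in i :: r then x j + y j else x j) = dfwith z i (x i + y i).
  by apply/funext => j; rewrite dfwithE inE; case: eqVneq => [->|].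
rewrite multilinearD // (bigID (fun S : {set 'I_n} => i \in S)) /= addrC.
congr (_ + _); last first.
  have -> : dfwith z i (y i) = fun j => if j \in r then dfwith x i (y i) j + y j
                                        else dfwith x i (y i) j.
    apply/funext => j; rewrite !dfwithE /z; case: eqVneq => [->|//].
    by rewrite (negPf ir).
  (* The subsets containing i are the i |: S for S a subset of r. *)
  rewrite IHr // [RHS](reindex_onto (fun S => i |: S) (fun S => S :\ i)) /=; last first.
    by move=> S /andP[_ iS]; rewrite finset.setD1K.
  apply: eq_big => [S|S Sr]; last first.
    congr phi; apply/funext => j; rewrite !inE !dfwithE.
    by case: eqVneq => [->|]; rewrite ?if_same.
  rewrite finset.setU11 andbT; apply/idP/andP => [Sr|[/fintype.subsetP Sr /eqP SE]].
    have iS : i \notin S by apply: contra ir => /(fintype.subsetP Sr).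
    split; last first.
      apply/eqP/finset.setP => j; rewrite !inE.
      by case: eqVneq => [->|//]; rewrite (negPf iS).
    apply/fintype.subsetP => j; rewrite !inE.
    by move=> /predU1P[->|/(fintype.subsetP Sr)->]; rewrite ?eqxx ?orbT.
  apply/fintype.subsetP => j; rewrite -SE !inE => /andP[ji].
  by rewrite (negPf ji) /= => jS; have := Sr j; rewrite !inE jS (negPf ji) => /(_ isT).
have -> : dfwith z i (x i) = z.
  by apply/funext => j; rewrite dfwithE /z; case: eqVneq => [->|//]; rewrite (negPf ir).
rewrite IHr //; apply: eq_bigl => S; apply/idP/andP => [Sr|[/fintype.subsetP Sr iS]].
  split; last by apply: contra ir => /(fintype.subsetP Sr).
  by apply/fintype.subsetP => j /(fintype.subsetP Sr); rewrite inE orbC => ->.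
apply/fintype.subsetP => j jS; have := Sr j jS.
by rewrite inE => /predU1P[ji|//]; rewrite -ji jS in iS.
Qed.

Lemma multilinear_expand phi x y : multilinear phi ->
  phi (fun i => x i + y i) =
  \sum_(S : {set 'I_n}) phi (fun i => if i \in S then y i else x i).
Proof.
move=> mphi; transitivity (phi (fun i => if i \in enum 'I_n then x i + y i else x i)).
  by congr phi; apply/funext => i; rewrite mem_enum.
rewrite multilinear_expand_on ?enum_uniq //; apply: eq_bigl => S.
by apply/fintype.subsetP => i _; rewrite mem_enum.
Qed.

Lemma multilinear_scale_on phi (r : seq 'I_n) x (a : K) : multilinear phi -> uniq r ->
  phi (fun i => if i \in r then a *: x i else x i) = a ^+ size r *: phi x.
Proof.
move=> mphi; elim: r => [_|i r IHr /= /andP[ir /IHr{}IHr]]; first by rewrite scale1r.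
pose z := fun j => if j \in r then a *: x j else x j.
have -> : (fun j => if j \in i :: r then a *: x j else x j) = dfwith z i (a *: x i).
  by apply/funext => j; rewrite dfwithE inE; case: eqVneq => [->|].
rewrite multilinearZ // exprS -scalerA -IHr; congr (_ *: phi _).
by apply/funext => j; rewrite dfwithE /z; case: eqVneq => [->|//]; rewrite (negPf ir).
Qed.

(** Each slot filled by a y contributes one factor a, so the coefficient of a^k is
    the sum over the k-element sets of slots in the full expansion. *)
Lemma multilinear_expand_scale phi x y a : multilinear phi ->
  phi (fun i => x i + a *: y i) = \sum_(k < n.+1) a ^+ k *:
    \sum_(S : {set 'I_n} | #|S| == k) phi (fun i => if i \in S then y i else x i).
Proof.
move=> mphi; rewrite multilinear_expand //.
have card_lt (S : {set 'I_n}) : (#|S| < n.+1)%N by rewrite ltnS -[leqRHS]card_ord max_card.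
rewrite (partition_big (fun S => Ordinal (card_lt S)) xpredT) //=.
apply: eq_bigr => k _; rewrite scaler_sumr; apply: eq_big => [S|S /eqP <- /=].
  by rewrite -val_eqE.
rewrite cardE -multilinear_scale_on ?enum_uniq //; congr phi; apply/funext => j.
by rewrite mem_enum; case: ifP.
Qed.

(** By symmetry the n ways to put b in a single slot contribute equally. *)
Lemma symmetric_multilinear_linear_coef phi (i0 : 'I_n) (a b : E) :
  symmetric_map phi ->
  \sum_(S : {set 'I_n} | #|S| == 1%N) phi (fun i => if i \in S then b else a) =
  phi (fun i => if i == i0 then b else a) *+ n.
Proof.
move=> sphi; rewrite (eq_bigr (fun=> phi (fun i => if i == i0 then b else a))).
  rewrite sumr_const; congr (_ *+ _).
  rewrite -[RHS]bin1 -[in RHS](card_ord n) -card_draws.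
  by apply: eq_card => S; rewrite inE.
move=> S /cards1P[i ->]; rewrite -(sphi (tperm i i0)); congr phi; apply/funext => j.
rewrite /= inE; congr (if _ then _ else _).
by rewrite -(inj_eq (@perm_inj _ (tperm i i0)) j i0) tpermR.
Qed.

End multilinear_expansion.

Section polynomial_coefficients.
Variables (K : numFieldType) (Y : lmodType K).

Lemma Vandermonde_natr_unit n : Vandermonde n (\row_(j < n) (j%:R : K)) \in unitmx.
Proof.
rewrite unitmxE det_Vandermonde unitfE; apply/prodf_neq0 => i _.
by apply/prodf_neq0 => j ij; rewrite !mxE subr_eq0 eqr_nat gtn_eqF.
Qed.

(** The values of a polynomial at 0, ..., n - 1 determine its n coefficients, even
    vector-valued ones: these are recovered by the inverse of the Vandermonde
    matrix of the nodes. *)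
Lemma natr_poly_eq0 n (c : 'I_n -> Y) :
  (forall m : nat, \sum_(k < n) m%:R ^+ k *: c k = 0) -> forall k, c k = 0.
Proof.
move=> c0 l; pose V := Vandermonde n (\row_(j < n) (j%:R : K)).
have VV := mulmxV (Vandermonde_natr_unit n).
transitivity (\sum_k (V *m invmx V) k l *: c k).
  rewrite VV (bigD1 l) //= big1 ?addr0 => [|k /negPf kl]; rewrite !mxE ?eqxx ?scale1r//.
  by rewrite kl scale0r.
transitivity (\sum_(j < n) (invmx V) j l *: \sum_(k < n) (j%:R : K) ^+ k *: c k).
  under [RHS]eq_bigr do rewrite scaler_sumr.
  rewrite exchange_big; apply: eq_bigr => k _; rewrite mxE scaler_suml.
  by apply: eq_bigr => j _; rewrite scalerA mulrC !mxE.
by apply: big1 => j _; rewrite c0 scaler0.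
Qed.

Lemma natr_poly_inj n (b c : 'I_n -> Y) :
  (forall m : nat, \sum_(k < n) (m%:R : K) ^+ k *: b k = \sum_(k < n) m%:R ^+ k *: c k) ->
  b =1 c.
Proof.
move=> bc k; apply/eqP; rewrite -subr_eq0; apply/eqP.
apply: (natr_poly_eq0 (c := fun k => b k - c k)) => m.
by under eq_bigr do rewrite scalerBr; rewrite sumrB bc subrr.
Qed.

End polynomial_coefficients.

(** The average of phi over the permutations of its arguments is symmetric and
    has the same restriction to the diagonal. *)
Lemma homogeneous_symmetrization (K : numFieldType) (E Y : lmodType K) n (P : E -> Y) :
  homogeneous_polynomial n P ->
  exists phi : ('I_n -> E) -> Y, associated_symmetric P phi.
Proof.
move=> [phi mphi PE].
exists (fun x => (n`!)%:R^-1 *: \sum_(s : 'S_n) phi (x \o s)); split=> [x i a u v|s x|x].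
- rewrite scalerA mulrC -scalerA -scalerDr; congr (_ *: _).
  rewrite scaler_sumr -big_split; apply: eq_bigr => s _ /=.
  have slot w : dfwith x i w \o s = dfwith (x \o s) (s^-1%g i) w.
    by apply/funext => j; rewrite /= !dfwithE -(can2_eq (permK s) (permKV s)).
  by rewrite !slot mphi.
- congr (_ *: _); rewrite (reindex_inj (mulIg s^-1)%g) /=; apply: eq_bigr => t _.
  by congr phi; apply/funext => j; rewrite /= permM permKV.
- rewrite (eq_bigr (fun=> P x)) => [|s _]; last by rewrite PE; congr phi.
  rewrite sumr_const -scaler_nat scalerA.
  have -> : #|'S_n| = n`! by rewrite -card_Sn; apply: eq_card.
  by rewrite mulVf ?scale1r // pnatr_eq0 -lt0n fact_gt0.
Qed.

Section homogeneous.
Variables (K : pzRingType) (E Y : lmodType K) (n : nat).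
Variables (P : E -> Y) (phi : ('I_n -> E) -> Y).
Hypothesis Pphi : associated_symmetric P phi.

Lemma homogeneous_scale a x : P (a *: x) = a ^+ n *: P x.
Proof.
have [mphi _ PE] := Pphi; rewrite !PE.
transitivity (a ^+ size (enum 'I_n) *: phi (fun=> x)); last first.
  by congr (_ ^+ _ *: _); exact: size_enum_ord.
rewrite -(multilinear_scale_on _ _ mphi (enum_uniq _)); congr phi.
by apply/funext => i; rewrite mem_enum.
Qed.

Variable i0 : 'I_n.

(** Up to the factor n, [partial_map a b] is the derivative of P at a in the
    direction b. *)
Definition partial_map (a b : E) : Y := phi (fun i => if i == i0 then b else a).

Lemma partial_map_is_linear a : linear (partial_map a).
Proof.
move=> s u v; have [mphi _ _] := Pphi; rewrite /partial_map.
have slot w : (fun i => if i == i0 then w else a) = dfwith (fun=> a) i0 w.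
  by apply/funext => i; rewrite dfwithE.
by rewrite !slot mphi.
Qed.

Lemma homogeneous_expand a b : exists c : nat -> Y,
  c 1%N = partial_map a b *+ n /\
  forall t, P (a + t *: b) = \sum_(k < n.+1) t ^+ k *: c k.
Proof.
have [mphi sphi PE] := Pphi.
exists (fun k => \sum_(S : {set 'I_n} | #|S| == k) phi (fun i => if i \in S then b else a)).
split=> [|t]; first exact: symmetric_multilinear_linear_coef.
by rewrite PE multilinear_expand_scale.
Qed.

End homogeneous.

(** * Orthogonally additive polynomials on matrix algebras *)

Lemma exprmx_expand (K : comPzRingType) d (A B : 'M[K]_d) n :
  exists M : nat -> 'M[K]_d,
    forall t : K, (A + t *: B) ^+ n = \sum_(k < n.+1) t ^+ k *: M k.
Proof.
elim: n => [|n [M IHn]].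
  by exists (fun=> 1) => t; rewrite expr0 big_ord1 scale1r.
(* The coefficient of t^k receives A M_k, except for k = n + 1 where M_k is
   arbitrary, and B M_(k-1), except for k = 0. *)
exists (fun k => (if (k <= n)%N then A *m M k else 0) +
                 (if k is k'.+1 then B *m M k' else 0)) => t.
rewrite exprS IHn; under [RHS]eq_bigr do rewrite scalerDr.
rewrite big_split /= mulrDl; congr (_ + _).
  rewrite [RHS]big_ord_recr /= ltnn scaler0 addr0 mulr_sumr; apply: eq_bigr => k _.
  by rewrite -ltnS ltn_ord -[LHS]scalemxAr.
rewrite [RHS]big_ord_recl /= scaler0 add0r mulr_sumr; apply: eq_bigr => k _.
by rewrite -[LHS]scalemxAr -[in LHS]scalemxAl scalerA /bump exprSr.
Qed.

Section orthogonally_additive_matrix.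
Variables (C : numClosedFieldType) (d n : nat) (Y : lmodType C).
Variables (P : 'M[C]_d -> Y) (phi : ('I_n -> 'M[C]_d) -> Y) (i0 : 'I_n).
Hypothesis Pphi : associated_symmetric P phi.
Hypothesis Padd : orthogonally_additive (fun A B => A *m B) P.

Let L := partial_map phi i0 1.
Let linL := partial_map_is_linear Pphi i0 1.
Let n_gt0 : (0 < n)%N. Proof. exact: leq_ltn_trans (ltn_ord i0). Qed.

(** The sum 1 + m e = (1 - e) + (m + 1) e is orthogonal; the coefficient of m in
    P (1 + m e) is n L e in general, and n P e by orthogonal additivity. *)
Lemma idempotent_partial_map (e : 'M[C]_d) : e *m e = e -> P e = L e.
Proof.
move=> ee.
have [c [c1 PE]] := homogeneous_expand Pphi i0 1 e.
(* b k is the coefficient of m^k in P (1 - e) + (m + 1)^n P e. *)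
pose b (k : 'I_n.+1) := (k == 0 :> nat)%:R *: P (1 - e) + P e *+ 'C(n, k).
have : b =1 c \o val.
  apply: natr_poly_inj => m; rewrite /= -PE.
  have -> : 1 + m%:R *: e = (1 - e) + (m%:R + 1) *: e.
    by rewrite scalerDl scale1r addrCA subrK addrC.
  rewrite Padd ?(homogeneous_scale Pphi).
  - under eq_bigr do rewrite scalerDr.
    rewrite big_split /= big_ord_recl expr0 !scale1r big1 ?addr0 => [|k _]; last first.
      by rewrite scale0r scaler0.
    congr (_ + _); rewrite exprD1n scaler_suml; apply: eq_bigr => k _.
    by rewrite -scalerMnl scalerMnr.
  - by rewrite -scalemxAr mulmxBl mul1mx ee subrr scaler0.
  - by rewrite -scalemxAl mulmxBr mulmx1 ee subrr scaler0.
move=> /(_ (@Ordinal n.+1 1 n_gt0)); rewrite /b /= scale0r add0r bin1 c1.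
move=> /eqP; rewrite -subr_eq0 -mulrnBl -scaler_nat scaler_eq0 pnatr_eq0.
by rewrite eqn0Ngt n_gt0 /= subr_eq0 => /eqP.
Qed.

(** A diagonalizable matrix is a combination of orthogonal idempotents, here the
    conjugates of the diagonal matrix units. *)
Lemma diagonalizable_partial_map (U : 'M[C]_d) (D : 'rV[C]_d) : U \in unitmx ->
  P (invmx U *m diag_mx D *m U) = L ((invmx U *m diag_mx D *m U) ^+ n).
Proof.
move=> Uu; pose e i := invmx U *m delta_mx i i *m U.
have eM i j : e i *m e j = if i == j then e i else 0.
  rewrite /e !mulmxA -(mulmxA _ U) mulmxV // mulmx1 -(mulmxA _ (delta_mx i i)).
  rewrite mul_delta_mx_cond; case: eqVneq => [->//|_].
  by rewrite mulr0n mulmx0 mul0mx.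
have diagE s : invmx U *m diag_mx s *m U = \sum_i s 0 i *: e i.
  rewrite diag_mx_sum_delta mulmx_sumr mulmx_suml; apply: eq_bigr => i _.
  by rewrite -scalemxAr -scalemxAl.
have powE m : (invmx U *m diag_mx D *m U) ^+ m =
    invmx U *m diag_mx (\row_i D 0 i ^+ m) *m U.
  elim: m => [|m IHm].
    rewrite expr0; have -> : \row_i D 0 i ^+ 0 = const_mx 1.
      by apply/rowP => i; rewrite !mxE.
    by rewrite diag_const_mx mulmx1 mulVmx.
  rewrite exprS IHm -mulmxE !mulmxA -(mulmxA _ U) mulmxV // mulmx1.
  rewrite -(mulmxA _ (diag_mx D)) mulmx_diag; congr (_ *m diag_mx _ *m _).
  by apply/rowP => i; rewrite !mxE exprS.
have Pe (r : seq 'I_d) : uniq r ->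
    P (\sum_(i <- r) D 0 i *: e i) = \sum_(i <- r) D 0 i ^+ n *: L (e i).
  elim: r => [_|i r IHr /= /andP[ir ur]].
    rewrite !big_nil -[0 in LHS](scale0r 0) (homogeneous_scale Pphi) expr0n.
    by rewrite eqn0Ngt n_gt0 scale0r.
  rewrite !big_cons Padd ?IHr ?(homogeneous_scale Pphi) //.
  - by rewrite idempotent_partial_map // eM eqxx.
  - rewrite -scalemxAl mulmx_sumr big_seq big1 ?scaler0 // => j jr.
    by rewrite -scalemxAr eM; case: eqVneq jr ir => [->->//|]; rewrite scaler0.
  - rewrite -scalemxAr mulmx_suml big_seq big1 ?scaler0 // => j jr.
    by rewrite -scalemxAl eM; case: eqVneq jr ir => [->->//|]; rewrite scaler0.
pose M : {linear _ -> _} := HB.pack L (GRing.isLinear.Build _ _ _ _ L linL).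
rewrite powE !diagE Pe ?index_enum_uniq // -[L in RHS]/(M : _ -> _) linear_sum.
by apply: eq_bigr => i _; rewrite linearZ mxE.
Qed.

(** Both sides are polynomial, and they agree on Hermitian matrices by the
    spectral theorem. Writing A = H + i N with H and N Hermitian, they agree at
    H + m N for all natural numbers m, so their coefficients along that line are
    the same and the variable may take the value i. *)
Lemma orthogonally_additive_power_mx (A : 'M[C]_d) : P A = L (A ^+ n).
Proof.
pose H : 'M[C]_d := 2^-1 *: (A + A ^t*%sesqui).
pose N : 'M[C]_d := (2 * 'i)^-1 *: (A - A ^t*%sesqui).
have AE : A = H + 'i *: N.
  have i2 : 'i * (2 * 'i)^-1 = 2^-1 :> C by rewrite invfM mulrCA divff ?mulr1 // neq0Ci.
  rewrite scalerA i2 -scalerDr addrCA -addrA subrr addr0 -[A + A]/(A *+ 2).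
  by rewrite -scaler_nat scalerA mulVf ?scale1r // pnatr_eq0.
have Hherm : H ^t*%sesqui = H.
  apply/matrixP => i j; rewrite !mxE rmorphM rmorphD /= conjCK addrC.
  by congr (_ * _); rewrite fmorphV rmorph_nat.
have Nherm : N ^t*%sesqui = N.
  apply/matrixP => i j; rewrite !mxE rmorphM rmorphB /= conjCK.
  rewrite fmorphV rmorphM /= conjCi rmorph_nat mulrN invrN mulNr -mulrN.
  by rewrite opprB.
have PL (m : nat) : P (H + m%:R *: N) = L ((H + m%:R *: N) ^+ n).
  have /orthomx_spectralP : H + m%:R *: N \is normalmx.
    apply/normalmxP; suff -> : (H + m%:R *: N) ^t*%sesqui = H + m%:R *: N by [].
    rewrite -[in RHS]Hherm -[in RHS]Nherm; apply/matrixP => i j.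
    by rewrite !mxE [LHS]rmorphD; congr (_ + _); rewrite [LHS]rmorphM rmorph_nat.
  by move=> ->; apply: diagonalizable_partial_map; exact: spectral_unit.
have [c [_ PE]] := homogeneous_expand Pphi i0 H N.
have [M ME] := exprmx_expand H N n.
pose L' : {linear _ -> _} := HB.pack L (GRing.isLinear.Build _ _ _ _ L linL).
have LE t : L ((H + t *: N) ^+ n) = \sum_(k < n.+1) t ^+ k *: L (M k).
  rewrite ME -[L in LHS]/(L' : _ -> _) linear_sum.
  by apply: eq_bigr => k _; rewrite linearZ.
have cM : (fun k : 'I_n.+1 => c k) =1 (fun k : 'I_n.+1 => L (M k)).
  by apply: natr_poly_inj => m; rewrite -PE PL LE.
by rewrite {1 2}AE PE LE; apply: eq_bigr => k _; rewrite (cM k).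
Qed.

(** The coefficient of m in P (1 + m A) is n L A by the expansion of P, and
    n Psi A by the binomial formula. *)
Lemma power_factorization_mx (Psi : {linear 'M[C]_d -> Y}) :
  (forall A, P A = Psi (A ^+ n)) -> Psi =1 L.
Proof.
move=> PPsi A; have [c [c1 PE]] := homogeneous_expand Pphi i0 1 A.
have : (fun k : 'I_n.+1 => Psi (A ^+ k) *+ 'C(n, k)) =1 (fun k : 'I_n.+1 => c k).
  apply: natr_poly_inj => m; rewrite -PE PPsi addrC exprD1n linear_sum.
  apply: eq_bigr => k _; rewrite [RHS]linearMn -scalerMnr; congr (_ *+ _).
  by rewrite -linearZ -natrX !scaler_nat; congr (Psi _); exact/esym/exprMn_n.
move=> /(_ (@Ordinal n.+1 1 n_gt0)) /=; rewrite expr1 bin1 c1.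
move=> /eqP; rewrite -subr_eq0 -mulrnBl -scaler_nat scaler_eq0 pnatr_eq0.
by rewrite eqn0Ngt n_gt0 /= subr_eq0 => /eqP.
Qed.

End orthogonally_additive_matrix.

(** * Schur's lemma *)

Section schur.
Variables (R : realType) (G : compactGroupType).
Implicit Types p q : irrep R G.
Local Open Scope sesquilinear_scope.

(** The kernel of an operator that commutes with p is an invariant subspace. *)
Lemma irrep_kernel0 p (M : 'M[R[i]]_(rdim p)) :
  (forall t, M *m p t = p t *m M) ->
  (exists2 u : 'cV_(rdim p), u != 0 & M *m u = 0) -> M = 0.
Proof.
move=> Mp [u u0 Mu0].
pose f : {linear 'cV[R[i]]_(rdim p) -> 'cV[R[i]]_(rdim p)} := mulmx M.
have mem_ker v : (v \in lker (linfun f)) = (M *m v == 0) by rewrite memv_ker lfunE.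
have [] := @rmx_irreducible _ _ p (lker (linfun f)).
- by move=> t v; rewrite !mem_ker mulmxA Mp -mulmxA => /eqP->; rewrite mulmx0.
- by move/vspaceP => /(_ u); rewrite mem_ker Mu0 eqxx memv0 (negPf u0).
move/vspaceP => kerE; apply/matrixP => i j.
have := kerE (delta_mx j 0); rewrite mem_ker memvf -colE => /eqP/colP/(_ i).
by rewrite !mxE.
Qed.

(** If a is an eigenvalue of M, then M - a commutes with p and has a nonzero
    kernel. The eigenvector is obtained from the transpose of M because
    [eigenvalue] is about row vectors. *)
Lemma schur_scalar p (M : 'M[R[i]]_(rdim p)) :
  (forall t, M *m p t = p t *m M) -> exists a, M = a%:M.
Proof.
move=> Mp; have [a /eigenvalueP[v vM v0]] := eigenvalue_closed M^T (rdim_gt0 p).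
exists a; apply/eqP; rewrite -subr_eq0; apply/eqP/irrep_kernel0 => [t|].
  by rewrite mulmxBl mulmxBr Mp scalar_mxC.
exists v^T; first by rewrite trmx_eq0.
rewrite mulmxBl -[M]trmxK -trmx_mul vM linearZ /= mul_scalar_mx.
by rewrite subrr.
Qed.

Lemma gram_eq0 m n (T : 'M[R[i]]_(m, n)) : T ^t* *m T = 0 -> T = 0.
Proof.
move=> TT; apply/matrixP => i j; rewrite [RHS]mxE.
have /eqP : \sum_k `|T k j| ^+ 2 = 0.
  rewrite -[RHS](_ : (T ^t* *m T) j j = 0); last by rewrite TT mxE.
  by rewrite mxE; apply: eq_bigr => k _; rewrite !mxE normCK mulrC.
rewrite psumr_eq0 => [/allP/(_ i)|k _]; last exact: exprn_ge0.
by rewrite mem_index_enum => /(_ isT); rewrite /= expf_eq0 normr_eq0 => /eqP.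
Qed.

(** For an intertwiner T, both T^* T and T T^* are scalar by Schur's lemma. They
    are the same scalar a, since T (T^* T) = (T T^* ) T, and a >= 0; if T were
    nonzero, T / sqrt a would be a unitary equivalence. *)
Lemma schur_inequivalent p q (T : 'M[R[i]]_(rdim p, rdim q)) :
  (forall t, T *m q t = p t *m T) -> ~ unitary_equiv q p -> T = 0.
Proof.
move=> Tqp neq.
have UV r (t : G) : (r : irrep R G) t *m r t ^t* = 1%:M by apply/unitarymxP/rmx_unitary.
have VU r (t : G) : (r : irrep R G) t ^t* *m r t = 1%:M by exact/mulmx1C/UV.
have Tpq t : T ^t* *m p t = q t *m T ^t*.
  rewrite -[RHS]mulmx1 -(VU p t) mulmxA -[X in _ = X *m _]mulmxA.
  by rewrite -map_mxM -trmx_mul -Tqp trmx_mul map_mxM mulmxA UV mul1mx.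
have [a TTa] : exists a, T ^t* *m T = a%:M.
  by apply: schur_scalar => t; rewrite -mulmxA Tqp !mulmxA Tpq.
have [b TTb] : exists b, T *m T ^t* = b%:M.
  by apply: schur_scalar => t; rewrite -mulmxA Tpq !mulmxA Tqp.
have [a0|a0] := eqVneq a 0; first by apply: gram_eq0; rewrite TTa a0 raddf0.
have TN0 : T != 0.
  apply: contra_eq_neq TTa => ->; rewrite mulmx0 eq_sym.
  apply: contra a0 => /eqP/matrixP/(_ (Ordinal (rdim_gt0 q)) (Ordinal (rdim_gt0 q))).
  by rewrite !mxE eqxx mulr1n => ->.
have ab : a = b.
  have /eqP : a *: T = b *: T.
    by rewrite -mul_mx_scalar -mul_scalar_mx -TTa -TTb mulmxA.
  by rewrite -subr_eq0 -scalerBl scaler_eq0 (negPf TN0) orbF subr_eq0 => /eqP.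
have a_ge0 : 0 <= a.
  have -> : a = (T ^t* *m T) (Ordinal (rdim_gt0 q)) (Ordinal (rdim_gt0 q)).
    by rewrite TTa mxE eqxx mulr1n.
  by rewrite mxE; apply: sumr_ge0 => k _; rewrite !mxE mulrC mul_conjC_ge0.
have sa : (sqrtC a)^-1 * ((sqrtC a)^-1)^* * a = 1.
  rewrite conj_Creal ?realV ?ger0_real ?sqrtC_ge0 // -invfM -expr2 sqrtCK.
  by rewrite mulVf.
have adjZ c : (c *: T) ^t* = c^* *: T ^t*.
  by apply/matrixP => i j; rewrite !mxE rmorphM.
case: neq; exists ((sqrtC a)^-1 *: T); split.
- apply/unitarymxP; rewrite adjZ -scalemxAl -scalemxAr scalerA TTb -ab.
  by rewrite scale_scalar_mx sa.
- apply/unitarymxP; rewrite trmxC_involutive adjZ -scalemxAl -scalemxAr scalerA TTa.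
  by rewrite scale_scalar_mx [X in X * a]mulrC sa.
- by move=> t; rewrite -scalemxAl Tqp -scalemxAr.
Qed.

End schur.

(** * Invariant integration on a compact group *)

Section haar_translation.
Import numFieldNormedType.Exports.
Variables (R : realType) (G : compactGroupType) (mu : probability (borel G) R).
Hypothesis mu_inv : translation_invariant mu.

Lemma translation_continuous (t : G) : continuous (fun s : G => t * s)%g.
Proof.
move=> s; apply: (@continuous_comp _ _ _ (fun s : G => (t, s)%g)
  (fun z : G * G => (z.1 * z.2)%g)); last exact: mulg_continuous.
by apply: cvg_pair; [exact: cvg_cst|exact: cvg_id].
Qed.

Lemma continuous_measurable_borel (f : G -> G) : continuous f ->
  measurable_fun [set: borel G] (f : borel G -> borel G).
Proof.
move=> cf; apply: (@measurability _ _ (borel G) (borel G) setT f (@open G) erefl).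
move=> _ [A oA <-]; rewrite setTI; apply: sub_sigma_algebra.
by move/continuousP: cf; apply.
Qed.

(** Change of variables: left invariance says that mu is its own image under the
    translation by t. *)
Lemma Rintegral_translate (t : G) (h : G -> R) : continuous h ->
  \int[mu]_s h (t * s)%g = \int[mu]_s h s.
Proof.
move=> ch; have mt := continuous_measurable_borel (@translation_continuous t).
have ih := continuous_integrable mu ch.
have iht : mu.-integrable [set: borel G] (EFin \o (fun s => h (t * s)%g)).
  apply: continuous_integrable => s.
  by apply: continuous_comp; [exact: translation_continuous|exact: ch].
rewrite /Rintegral; congr fine.
have := @integral_pushforward _ _ (borel G) (borel G) R (fun s : G => t * s)%g mt mu setT
  (EFin \o h) _ iht measurableT.
rewrite preimage_setT => <-; last exact: (measurable_int mu ih).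
apply: eq_measure_integral => A mA _.
transitivity (mu [set (t^-1 * s)%g | s in A]%classic); last exact: mu_inv.
rewrite /= /pushforward; congr (mu _); apply/seteqP; split=> s /=.
  by move=> As; exists (t * s)%g; rewrite // mulKg.
by move=> [x Ax <-]; rewrite mulVKg.
Qed.

Lemma cintegral_translate (t : G) (f : G -> R[i]^o) : continuous f ->
  cintegral mu (fun s => f (t * s)%g) = cintegral mu f.
Proof.
move=> cf; rewrite /cintegral.
rewrite (Rintegral_translate t (h := fun s => complex.Re (f s))).
  rewrite (Rintegral_translate t (h := fun s => complex.Im (f s))) //.
  by move=> s; apply: continuous_comp; [exact: cf|exact: continuous_Im].
by move=> s; apply: continuous_comp; [exact: cf|exact: continuous_Re].
Qed.

End haar_translation.

Section matrix_integral.
Import numFieldNormedType.Exports.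
Variables (R : realType) (G : compactGroupType) (mu : probability (borel G) R).

Definition mxcontinuous m n (F : G -> 'M[R[i]]_(m, n)) : Prop :=
  forall i j, continuous (fun s => F s i j : R[i]^o).

Definition mxintegral m n (F : G -> 'M[R[i]]_(m, n)) : 'M[R[i]]_(m, n) :=
  \matrix_(i, j) cintegral mu (fun s => F s i j).

Lemma mxcontinuous_cst m n (A : 'M[R[i]]_(m, n)) : mxcontinuous (fun=> A).
Proof. by move=> i j s; exact: cvg_cst. Qed.

Lemma mxcontinuousM m n k (F : G -> 'M[R[i]]_(m, n)) (H : G -> 'M[R[i]]_(n, k)) :
  mxcontinuous F -> mxcontinuous H -> mxcontinuous (fun s => F s *m H s).
Proof.
move=> cF cH i j; under eq_fun do rewrite mxE.
by apply: continuous_sumc => l; apply: continuous_mulc; [exact: cF|exact: cH].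
Qed.

Lemma mxcontinuousZ m n (f : G -> R[i]^o) (F : G -> 'M[R[i]]_(m, n)) :
  continuous f -> mxcontinuous F -> mxcontinuous (fun s => f s *: F s).
Proof.
move=> cf cF i j; under eq_fun do rewrite mxE.
by apply: continuous_mulc; [exact: cf|exact: cF].
Qed.

Lemma irrep_entryE (p : irrep R G) i j s :
  p s i j = coef p (delta_mx j 0) (delta_mx i 0) s.
Proof. by rewrite /coef inner_delta -colE mxE. Qed.

Lemma mxcontinuous_irrep (p : irrep R G) : mxcontinuous p.
Proof.
by move=> i j; under eq_fun do rewrite irrep_entryE; exact: continuous_coef.
Qed.

Lemma mxcontinuous_irrepV (p : irrep R G) : mxcontinuous (fun s => p s^-1%g).
Proof.
move=> i j s; apply: (@continuous_comp _ _ _ (fun s : G => s^-1%g)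
  (fun s => p s i j : R[i]^o)).
  exact: invg_continuous.
exact: mxcontinuous_irrep.
Qed.

Lemma mxintegral_mull m n k (A : 'M[R[i]]_(m, n)) (F : G -> 'M[R[i]]_(n, k)) :
  mxcontinuous F -> mxintegral (fun s => A *m F s) = A *m mxintegral F.
Proof.
move=> cF; apply/matrixP => i j; rewrite !mxE.
under eq_fun do rewrite mxE.
rewrite cintegral_sum => [|l].
  apply: eq_bigr => l _; rewrite mxE mulrC -cintegralZ; last exact: cF.
  by congr cintegral; apply/funext => s; rewrite mulrC.
by apply: continuous_mulc; [move=> s; exact: cvg_cst|exact: cF].
Qed.

Lemma mxintegral_mulr m n k (F : G -> 'M[R[i]]_(m, n)) (A : 'M[R[i]]_(n, k)) :
  mxcontinuous F -> mxintegral (fun s => F s *m A) = mxintegral F *m A.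
Proof.
move=> cF; apply/matrixP => i j; rewrite !mxE.
under eq_fun do rewrite mxE.
rewrite cintegral_sum => [|l].
  by apply: eq_bigr => l _; rewrite mxE -cintegralZ; last exact: cF.
by apply: continuous_mulc; [exact: cF|move=> s; exact: cvg_cst].
Qed.

Lemma mxintegral_linear m n a (F H : G -> 'M[R[i]]_(m, n)) :
  mxcontinuous F -> mxcontinuous H ->
  mxintegral (fun s => a *: F s + H s) = a *: mxintegral F + mxintegral H.
Proof.
move=> cF cH; apply/matrixP => i j; rewrite !mxE mulrC -cintegralZ; last exact: cF.
rewrite -cintegralD; last exact: cH.
  by congr (cintegral mu _); apply/funext => s; rewrite !mxE mulrC.
by apply: (continuous_mulc (cF i j)) => s; exact: cvg_cst.
Qed.

Lemma cintegral_mxtrace n (F : G -> 'M[R[i]]_n) : mxcontinuous F ->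
  cintegral mu (fun s => \tr (F s)) = \tr (mxintegral F).
Proof.
move=> cF; rewrite /mxtrace cintegral_sum => [|i]; last exact: cF.
by apply: eq_bigr => i _; rewrite mxE.
Qed.

Lemma cintegral_cst (c : R[i]) : cintegral mu (fun=> c) = c.
Proof.
by rewrite /cintegral !Rintegral_cst //= !probability_setT !mulr1; case: c.
Qed.

End matrix_integral.

Section irrep_group.
Variables (R : realType) (G : compactGroupType) (p : irrep R G).

(** The matrix p(1) is idempotent and invertible. *)
Lemma irrep1 : p 1%g = 1%:M.
Proof.
have pu := unitarymx_unit (rmx_unitary p 1%g).
have pp : p 1%g *m p 1%g = p 1%g by rewrite -rmxM mulg1.
by rewrite -[LHS](mulKmx pu) pp mulVmx.
Qed.

Lemma irrepVM s : p s^-1%g *m p s = 1%:M.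
Proof. by rewrite -rmxM mulVg irrep1. Qed.

End irrep_group.

(** * The Fourier transform of trigonometric polynomials *)

Section synthesis.
Variables (R : realType) (G : compactGroupType).
Implicit Types q : irrep R G.

(** The factor [rdim q] makes [fourier mu q] the inverse of [synthesis q], and
    makes the synthesis of the identity matrix the unit of the block of q. *)
Definition synthesis_fun q (B : 'M[R[i]]_(rdim q)) : G -> R[i]^o :=
  fun t => (rdim q)%:R * \tr (B *m q t).

Arguments synthesis_fun : clear implicits.

Lemma synthesis_trigpoly q B : synthesis_fun q B \in @trigpoly R G.
Proof.
have -> : synthesis_fun q B = \sum_i \sum_j
    ((rdim q)%:R * B i j) *: coef q (delta_mx i 0) (delta_mx j 0).
  apply/funext => t; rewrite fct_sumE /synthesis_fun mulr_sumr.
  apply: eq_bigr => i _; rewrite fct_sumE mxE mulr_sumr; apply: eq_bigr => j _.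
  by rewrite mulrA irrep_entryE.
by apply: rpred_sum => i _; apply: rpred_sum => j _; apply/rpredZ/coef_trigpoly.
Qed.

Definition synthesis q B : trigPoly R G := TrigPoly (@synthesis_trigpoly q B).
Arguments synthesis : clear implicits.

Lemma synthesis_is_linear q : linear (synthesis q).
Proof.
move=> a A B; apply/val_inj/funext => t /=.
by rewrite /synthesis_fun mulmxDl -scalemxAl linearD linearZ /= mulrDr mulrCA.
Qed.
HB.instance Definition _ q :=
  GRing.isLinear.Build _ _ _ _ (synthesis q) (@synthesis_is_linear q).

Lemma synthesis1 q : synthesis q 1%:M = (rdim q)%:R *: trig_char q.
Proof. by apply/val_inj/funext => t /=; rewrite /synthesis_fun mul1mx. Qed.

Lemma coef_synthesis q u v :
  coef q u v = synthesis q ((rdim q)%:R^-1 *: (u *m v ^t*%sesqui)).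
Proof.
apply/funext => t /=; rewrite /synthesis_fun -scalemxAl linearZ /= mulrA divff ?mul1r.
  by rewrite -mulmxA mxtrace_mulC -mulmxA /coef /inner trace_mx11.
by rewrite pnatr_eq0 -lt0n rdim_gt0.
Qed.

End synthesis.
Arguments synthesis {R G} q B.

(** As q(s^-1) is the adjoint of q(s), this is the usual Fourier coefficient. *)
HB.lock Definition fourier (R : realType) (G : compactGroupType)
    (mu : probability (borel G) R) (q : irrep R G) (f : trigPoly R G) : 'M[R[i]]_(rdim q) :=
  mxintegral mu (fun s => f s *: q s^-1%g).

Section fourier.
Import numFieldNormedType.Exports.
Variables (R : realType) (G : compactGroupType) (mu : probability (borel G) R).
Implicit Types (q : irrep R G) (f : trigPoly R G).
Local Notation fourier := (fourier mu).

Lemma fourierE q f : fourier q f = mxintegral mu (fun s => f s *: q s^-1%g).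
Proof. by rewrite unlock. Qed.

Let cont f : continuous f.
Proof. exact/trigpoly_continuous/trigPolyP. Qed.

Lemma fourier_is_linear q : linear (fourier q).
Proof.
move=> a f g.
have cq (h : trigPoly R G) := mxcontinuousZ (@cont h) (@mxcontinuous_irrepV _ _ q).
rewrite !fourierE -(mxintegral_linear mu a (cq f) (cq g)).
congr mxintegral; apply/funext => s.
by rewrite -[(a *: f + g : trigPoly R G) s]/(a * f s + g s) scalerDl scalerA.
Qed.
HB.instance Definition _ q :=
  GRing.isLinear.Build _ _ _ _ (fourier q) (@fourier_is_linear q).

(** In f * synthesis q B (t), the matrix q(s^-1 t) splits as q(s^-1) q(t), so the
    integral over s acts on f(s) q(s^-1) alone. *)
Lemma trig_conv_synthesis f q B :
  trig_conv mu f (synthesis q B) = synthesis q (B *m fourier q f).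
Proof.
apply/val_inj/funext => t; rewrite /= /convolution /synthesis_fun.
have cfq := mxcontinuousZ (@cont f) (@mxcontinuous_irrepV _ _ q).
have cBfq := mxcontinuousM (@mxcontinuous_cst _ G _ _ B) cfq.
have cBfqt := mxcontinuousM cBfq (@mxcontinuous_cst _ G _ _ (q t)).
rewrite fourierE -mxintegral_mull // -mxintegral_mulr // -cintegral_mxtrace //.
rewrite mulrC -cintegralZ.
  congr (cintegral mu _); apply/funext => s; rewrite mulrCA mulrC; congr (_ * _).
  by rewrite -scalemxAr -scalemxAl linearZ /= rmxM mulmxA.
by move=> s; rewrite /mxtrace; apply: continuous_sumc => i; exact: cBfqt.
Qed.

End fourier.

(** * Schur orthogonality *)

Lemma mulmx_delta_entry (K : pzRingType) m n k l
    (A : 'M[K]_(m, n)) (B : 'M[K]_(k, l)) a b i j :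
  (A *m delta_mx a b *m B) i j = A i a * B b j.
Proof.
rewrite -(mul_delta_mx (0 : 'I_1)) mulmxA -colE -mulmxA -rowE.
by rewrite mxE big_ord1 !mxE.
Qed.

Section schur_orthogonality.
Import numFieldNormedType.Exports.
Variables (R : realType) (G : compactGroupType) (mu : probability (borel G) R).
Hypothesis mu_inv : translation_invariant mu.
Implicit Types p q : irrep R G.

Definition average p q (M : 'M[R[i]]_(rdim p, rdim q)) : 'M[R[i]]_(rdim p, rdim q) :=
  mxintegral mu (fun s => p s *m M *m q s^-1%g).

Lemma mxcontinuous_average p q (M : 'M[R[i]]_(rdim p, rdim q)) :
  mxcontinuous (fun s => p s *m M *m q s^-1%g).
Proof.
apply: mxcontinuousM; last exact: mxcontinuous_irrepV.
by apply: mxcontinuousM; [exact: mxcontinuous_irrep|exact: mxcontinuous_cst].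
Qed.

(** Translate the variable of integration by t. *)
Lemma average_intertwines p q (M : 'M[R[i]]_(rdim p, rdim q)) t :
  average M *m q t = p t *m average M.
Proof.
have cM := @mxcontinuous_average p q M.
rewrite -mxintegral_mulr // -mxintegral_mull //; apply/matrixP => i j; rewrite !mxE.
rewrite -(cintegral_translate mu_inv t).
  congr (cintegral mu _); apply/funext => s; congr (fun_of_matrix _ i j).
  by rewrite invgM !rmxM -!mulmxA irrepVM mulmx1 !mulmxA.
by apply: mxcontinuousM => //; exact: mxcontinuous_cst.
Qed.

Lemma average_inequivalent p q (M : 'M[R[i]]_(rdim p, rdim q)) :
  ~ unitary_equiv q p -> average M = 0.
Proof. by apply: schur_inequivalent => t; exact: average_intertwines. Qed.

(** The average is scalar by Schur's lemma, and has the trace of M because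
    conjugation by p(s) preserves the trace. *)
Lemma average_irrep p (M : 'M[R[i]]_(rdim p)) :
  average M = ((rdim p)%:R^-1 * \tr M)%:M.
Proof.
have [t|a aE] := @schur_scalar _ _ p (average M); first exact: average_intertwines.
rewrite aE; congr (_%:M); apply: (mulfI (x := (rdim p)%:R)).
  by rewrite pnatr_eq0 -lt0n rdim_gt0.
rewrite mulrA mulfV ?mul1r ?pnatr_eq0 -?lt0n ?rdim_gt0 // mulr_natl -mxtrace_scalar -aE.
rewrite /average -cintegral_mxtrace; last exact: mxcontinuous_average.
rewrite -[RHS](cintegral_cst mu); congr (cintegral mu _); apply/funext => s.
by rewrite mxtrace_mulC mulmxA irrepVM mul1mx.
Qed.

(** The products of an entry of p(s) with an entry of q(s^-1) are the entries of
    p(s) E q(s^-1) for matrix units E, so their integrals are entries of averages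
    of matrix units. *)
Lemma fourier_synthesisE p q (B : 'M[R[i]]_(rdim p)) i j :
  fourier mu q (synthesis p B) i j = (rdim p)%:R *
    \sum_k \sum_l B k l * average (delta_mx k i : 'M[R[i]]_(rdim p, rdim q)) l j.
Proof.
rewrite fourierE mxE.
transitivity (cintegral mu (fun s => \sum_k \sum_l
    (p s *m (delta_mx k i : 'M[R[i]]_(rdim p, rdim q)) *m q s^-1%g) l j * (B k l * (rdim p)%:R))).
  congr (cintegral mu _); apply/funext => s; rewrite mxE /= /synthesis_fun.
  rewrite mulr_sumr mulr_suml; apply: eq_bigr => k _.
  rewrite mxE mulr_sumr mulr_suml; apply: eq_bigr => l _.
  rewrite mulmx_delta_entry; have mul4 (a b c d : R[i]) : a * (b * c) * d = c * d * (b * a).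
    by rewrite mulrA mulrAC -mulrA mulrC (mulrC d) [a * b]mulrC.
  exact: mul4.
have cA k l : continuous (fun s =>
    (p s *m (delta_mx k i : 'M[R[i]]_(rdim p, rdim q)) *m q s^-1%g) l j : R[i]^o).
  exact: mxcontinuous_average.
have cAB k l : continuous (fun s => (p s *m (delta_mx k i : 'M[R[i]]_(rdim p, rdim q))
    *m q s^-1%g) l j * (B k l * (rdim p)%:R) : R[i]^o).
  by apply: (continuous_mulc (cA k l)) => s; exact: cvg_cst.
rewrite cintegral_sum => [|k]; last by apply: continuous_sumc => l; exact: cAB.
rewrite mulr_sumr; apply: eq_bigr => k _; rewrite cintegral_sum => [|l]; last exact: cAB.
rewrite mulr_sumr; apply: eq_bigr => l _; rewrite cintegralZ; last exact: cA.
by rewrite [average _ l j]mxE mulrC [RHS]mulrA [X in X * _ = _]mulrC.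
Qed.

Lemma fourier_synthesis_inequivalent p q (B : 'M[R[i]]_(rdim p)) :
  ~ unitary_equiv q p -> fourier mu q (synthesis p B) = 0.
Proof.
move=> neq; apply/matrixP => i j; rewrite fourier_synthesisE [RHS]mxE.
rewrite big1 ?mulr0 // => k _; rewrite big1 // => l _.
by rewrite average_inequivalent // mxE mulr0.
Qed.

Lemma fourier_synthesis p (B : 'M[R[i]]_(rdim p)) : fourier mu p (synthesis p B) = B.
Proof.
apply/matrixP => i j; rewrite fourier_synthesisE.
have trE k : \tr (delta_mx k i : 'M[R[i]]_(rdim p)) = (k == i)%:R.
  rewrite /mxtrace (bigD1 k) //= big1 ?addr0 => [|l /negPf lk]; rewrite mxE ?eqxx //.
  by rewrite lk.
have aE k l : average (delta_mx k i : 'M[R[i]]_(rdim p, rdim p)) l j =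
    (rdim p)%:R^-1 * ((k == i) && (l == j))%:R.
  by rewrite average_irrep mxE trE -mulrnAr -mulrnA mulnb.
rewrite (bigD1 i) //= [X in _ + X]big1 ?addr0 => [|k /negPf ki]; last first.
  by rewrite big1 // => l _; rewrite aE ki !mulr0.
rewrite (bigD1 j) //= [X in _ + X]big1 ?addr0 => [|l /negPf lj]; last first.
  by rewrite aE lj andbF !mulr0.
rewrite aE !eqxx mulr1 mulrCA mulfV ?mulr1 //.
by rewrite pnatr_eq0 -lt0n rdim_gt0.
Qed.

End schur_orthogonality.

(** * Fourier inversion and the convolution theorem *)

Section fourier_inversion.
Import numFieldNormedType.Exports.
Variables (R : realType) (G : compactGroupType) (mu : probability (borel G) R).
Hypothesis mu_inv : translation_invariant mu.
Local Notation dual := (unitary_dual R G).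
Local Notation theta c := (synthesis (repr (c : dual))).
Local Notation F c := (fourier mu (repr (c : dual))).
Implicit Types (f g : trigPoly R G) (r : seq dual).

Lemma big_dual_seq (V : nmodType) (H : dual -> V) r : uniq r ->
  (forall c, c \notin r -> H c = 0) ->
  \sum_(c \in [set: dual]%classic) H c = \sum_(c <- r) H c.
Proof.
move=> ur H0; rewrite (fsbigE r) // => [|c _]; last exact: H0.
by apply: eq_bigl => c; rewrite in_setT.
Qed.

Lemma repr_inequivalent (c c' : dual) : c != c' ->
  ~ unitary_equiv (repr c) (repr c').
Proof.
move=> cc' e; move/eqP: cc'; apply.
rewrite -[c]reprK -[c']reprK; apply/eqquotP; exact/asboolP.
Qed.

Lemma repr_pi_equiv (p : irrep R G) : unitary_equiv p (repr (\pi_dual p)%qT).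
Proof. by apply/asboolP; have /eqquotP := esym (reprK (\pi_dual p)%qT). Qed.

Lemma fourier_synthesis_dual (c c' : dual) (B : 'M[R[i]]_(rdim (repr c))) :
  c != c' -> F c' (theta c B) = 0.
Proof.
by move=> cc'; apply/fourier_synthesis_inequivalent/repr_inequivalent; rewrite // eq_sym.
Qed.

Lemma fourier_sum_synthesis r (B : forall c : dual, 'M[R[i]]_(rdim (repr c))) c :
  uniq r -> F c (\sum_(c' <- r) theta c' (B c')) = if c \in r then B c else 0.
Proof.
move=> ur; rewrite linear_sum; case: ifP => cr.
  rewrite (bigD1_seq c) //= [X in _ + X]big1 ?addr0 => [|c' c'c].
    exact: fourier_synthesis.
  exact: fourier_synthesis_dual.
rewrite big_seq big1 // => c' c'r; apply: fourier_synthesis_dual.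
by apply: contraFneq cr => <-.
Qed.

Definition fourier_supported r f : Prop :=
  uniq r /\ forall c, c \notin r -> F c f = 0.

(** A common support lets the sums over the dual attached to f, to g and to their
    combinations be compared term by term. *)
Lemma joint_support r r' f g : fourier_supported r f -> fourier_supported r' g ->
  exists s, [/\ fourier_supported s f, fourier_supported s g &
                forall a, fourier_supported s (a *: f + g)].
Proof.
move=> [_ f0] [_ g0]; exists (undup (r ++ r')).
have f0s c : c \notin undup (r ++ r') -> F c f = 0.
  by rewrite mem_undup mem_cat negb_or => /andP[/f0].
have g0s c : c \notin undup (r ++ r') -> F c g = 0.
  by rewrite mem_undup mem_cat negb_or => /andP[_ /g0].
have us := undup_uniq (r ++ r').
split; [by split | by split | move=> a; split; first by []].
by move=> c cs; rewrite linearP /= f0s // g0s // scaler0 addr0.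
Qed.

Lemma big_fourier_supported (V : nmodType)
    (H : forall c : dual, 'M[R[i]]_(rdim (repr c)) -> V) r f :
  (forall c, H c 0 = 0) -> fourier_supported r f ->
  \sum_(c \in [set: dual]%classic) H c (F c f) = \sum_(c <- r) H c (F c f).
Proof. by move=> H0 [ur f0]; apply: big_dual_seq => // c /f0->. Qed.
Arguments big_fourier_supported {V} H {r f}.

Definition fourier_inverts f : Prop := (exists r, fourier_supported r f) /\
  f = \sum_(c \in [set: dual]%classic) theta c (F c f).

Lemma fourier_inverts0 : fourier_inverts 0.
Proof.
split; first by exists [::]; split=> // c _; rewrite linear0.
by rewrite fsbig1 // => c _; rewrite !linear0.
Qed.

Lemma fourier_inverts_synthesis c (B : 'M[R[i]]_(rdim (repr c))) :
  fourier_inverts (theta c B).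
Proof.
have supp : fourier_supported [:: c] (theta c B).
  by split=> // c'; rewrite inE eq_sym => /fourier_synthesis_dual.
split; first by exists [:: c].
rewrite (big_fourier_supported (fun c => theta c) _ supp) => [|c']; last exact: linear0.
by rewrite big_seq1 fourier_synthesis.
Qed.

Lemma fourier_inverts_linear a f g : fourier_inverts f -> fourier_inverts g ->
  fourier_inverts (a *: f + g).
Proof.
move=> [[rf sf] fE] [[rg sg] gE]; have [r [rfs rgs rfgs]] := joint_support sf sg.
have theta0 c : theta c 0 = 0 by exact: linear0.
split; first by exists r; exact: rfgs.
rewrite {1}fE {1}gE (big_fourier_supported (fun c => theta c) theta0 rfs).
rewrite (big_fourier_supported (fun c => theta c) theta0 rgs).
rewrite (big_fourier_supported (fun c => theta c) theta0 (rfgs a)).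
rewrite scaler_sumr -big_split.
by apply: eq_bigr => c _; rewrite [F c (_ + _)]linearP [RHS]linearP.
Qed.

(** By linearity it suffices to treat matrix coefficients, which are syntheses;
    for these the inversion is Schur orthogonality. *)
Lemma fourier_inversion f : fourier_inverts f.
Proof.
suff [f' [ff' Hf']] : exists f', f' = f :> (G -> R[i]^o) /\ fourier_inverts f'.
  by rewrite -(val_inj ff').
have /lin_span_trigpolyE[m [a [x [Sx ->]]]] := trigPolyP f.
apply: (big_ind (fun g : G -> R[i]^o =>
  exists f' : trigPoly R G, f' = g :> (G -> R[i]^o) /\ fourier_inverts f')).
- by exists 0; split=> //; exact: fourier_inverts0.
- move=> _ _ [f1 [<- H1]] [f2 [<- H2]]; exists (1 *: f1 + f2); split.
    by rewrite scale1r.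
  exact: fourier_inverts_linear.
move=> j _; have [p [u [v ->]]] := Sx j.
have [U [U1 U2 UI]] := repr_pi_equiv p.
set c := (\pi_dual p)%qT in U U1 U2 UI.
(* Transport the coefficient along the equivalence U to the chosen representative. *)
have -> : coef p u v = coef (repr c) (U *m u) (U *m v).
  have UU : U ^t*%sesqui *m U = 1%:M.
    by have /unitarymxP := U2; rewrite trmxC_involutive.
  apply/funext => t; rewrite /coef /inner mulmxA -UI trmx_mul map_mxM -!mulmxA.
  by rewrite (mulmxA (U ^t*%sesqui)) UU mul1mx.
rewrite coef_synthesis; set B := (X in synthesis _ X).
exists (a j *: synthesis (repr c) B + 0); split; first by rewrite addr0.
by apply: fourier_inverts_linear; [exact: fourier_inverts_synthesis|exact: fourier_inverts0].
Qed.

Lemma fourier_inj f g : (forall c : dual, F c f = F c g) -> f = g.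
Proof.
move=> fg; rewrite [f](fourier_inversion f).2 [g](fourier_inversion g).2.
by apply: eq_fsbigr => c _; rewrite fg.
Qed.

Lemma trig_conv_is_linear f : linear (trig_conv mu f).
Proof.
have cont h : continuous (h : trigPoly R G) by exact/trigpoly_continuous/trigPolyP.
move=> a g h; apply/val_inj/funext => t /=.
have cfg k : continuous (fun s => f s * (k : trigPoly R G) (s^-1 * t)%g).
  apply: (continuous_mulc (@cont f)) => s.
  apply: (@continuous_comp _ _ _ (fun s : G => (s^-1 * t)%g)); last exact: cont.
  apply: (@continuous_comp _ _ _ (fun s : G => (s^-1, t)%g)
    (fun z : G * G => (z.1 * z.2)%g)); last exact: mulg_continuous.
  by apply: cvg_pair; [exact: invg_continuous|exact: cvg_cst].
transitivity (cintegral mu (fun s => f s * g (s^-1 * t)%g * a + f s * h (s^-1 * t)%g)).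
  congr (cintegral mu _); apply/funext => s.
  transitivity (f s * (a * g (s^-1 * t)%g + h (s^-1 * t)%g)); first by [].
  by rewrite mulrDr; congr (_ + _); rewrite mulrCA; exact: mulrC.
rewrite cintegralD; last exact: cfg.
  rewrite cintegralZ; last exact: cfg.
  by congr (_ + _); exact: mulrC.
by apply: (continuous_mulc (cfg g)) => s; exact: cvg_cst.
Qed.
HB.instance Definition _ f :=
  GRing.isLinear.Build _ _ _ _ (trig_conv mu f) (@trig_conv_is_linear f).

(** The order of the factors is reversed: with the convention of [synthesis], the
    block of q is the opposite of the algebra of matrices. *)
Lemma fourier_conv f g c : F c (trig_conv mu f g) = F c g *m F c f.
Proof.
have [[r sg] ->] := fourier_inversion g; have [ur _] := sg.
rewrite (big_fourier_supported (fun c => theta c) _ sg) => [|c']; last exact: linear0.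
rewrite linear_sum; under eq_bigr do rewrite /= trig_conv_synthesis.
rewrite !fourier_sum_synthesis //; case: ifP => // _.
by rewrite mul0mx.
Qed.

Lemma conv_powS n f : conv_pow mu n.+2 f = trig_conv mu f (conv_pow mu n.+1 f).
Proof. by []. Qed.

Lemma fourier_conv_pow n f c : (0 < n)%N -> F c (conv_pow mu n f) = F c f ^+ n.
Proof.
case: n => // n _; elim: n => [|n IHn] //.
by rewrite conv_powS fourier_conv IHn [RHS]exprSr.
Qed.

End fourier_inversion.
Arguments big_fourier_supported {R G mu V} H {r f}.

(** * Factorization of orthogonally additive polynomials *)

Section factorization.
Variables (R : realType) (G : compactGroupType) (mu : probability (borel G) R).
Hypothesis mu_inv : translation_invariant mu.
Variables (n : nat) (X : lmodType R[i]) (P : trigPoly R G -> X).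
Variables (phi : ('I_n -> trigPoly R G) -> X) (i0 : 'I_n).
Hypothesis Pphi : associated_symmetric P phi.
Hypothesis Padd : orthogonally_additive (trig_conv mu) P.
Local Notation dual := (unitary_dual R G).
Local Notation theta c := (synthesis (repr (c : dual))).
Local Notation F c := (fourier mu (repr (c : dual))).

Let n_gt0 : (0 < n)%N. Proof. exact: leq_ltn_trans (ltn_ord i0). Qed.

Lemma associated_symmetric_synthesis q :
  associated_symmetric (fun B => P (synthesis q B)) (fun x => phi (synthesis q \o x)).
Proof.
have [mphi sphi PE] := Pphi; split=> [x i a u v|s x|B].
- have slot w : synthesis q \o dfwith x i w = dfwith (synthesis q \o x) i (synthesis q w).
    by apply/funext => j; rewrite /= !dfwithE; case: eqP.
  by rewrite !slot linearP mphi.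
- exact: sphi.
- exact: PE.
Qed.

Lemma orthogonally_additive_synthesis q :
  orthogonally_additive (fun A B => A *m B) (fun B => P (synthesis q B)).
Proof.
move=> A B AB BA; rewrite linearD Padd //.
  by rewrite trig_conv_synthesis fourier_synthesis // BA linear0.
by rewrite trig_conv_synthesis fourier_synthesis // AB linear0.
Qed.

(** Syntheses from distinct classes annihilate each other. *)
Lemma orthogonally_additive_seq (r : seq dual) (B : forall c : dual, 'M[R[i]]_(rdim (repr c))) :
  uniq r -> P (\sum_(c <- r) theta c (B c)) = \sum_(c <- r) P (theta c (B c)).
Proof.
elim: r => [_|c r IHr /= /andP[cr ur]].
  rewrite !big_nil -[0 in LHS](scale0r 0) (homogeneous_scale Pphi) expr0n.
  by rewrite eqn0Ngt n_gt0 scale0r.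
have orth c' : F c' (theta c (B c)) *m F c' (\sum_(j <- r) theta j (B j)) = 0 /\
    F c' (\sum_(j <- r) theta j (B j)) *m F c' (theta c (B c)) = 0.
  rewrite fourier_sum_synthesis //; have [<-|cc'] := eqVneq c c'.
    by rewrite (negPf cr) mul0mx mulmx0.
  by rewrite (fourier_synthesis_dual mu_inv _ cc') mul0mx mulmx0.
rewrite !big_cons -IHr //; apply: Padd; apply: (fourier_inj mu_inv) => c';
  by rewrite fourier_conv // linear0; have [] := orth c'.
Qed.

(** Since theta c 1 is d_c chi_c, this is the term of index c of the expected
    formula, as a function of the Fourier coefficient. *)
Definition component_map (c : dual) (A : 'M[R[i]]_(rdim (repr c))) : X :=
  phi (fun i => if i == i0 then theta c A else theta c 1%:M).

Lemma component_mapE c : component_map (c := c) =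
  partial_map (fun x => phi (synthesis (repr c) \o x)) i0 1.
Proof.
by apply/funext => A; congr phi; apply/funext => i /=; case: eqP.
Qed.

Lemma component_map_is_linear c : linear (component_map (c := c)).
Proof.
rewrite component_mapE; apply: partial_map_is_linear.
exact: associated_symmetric_synthesis.
Qed.

Lemma power_component c (A : 'M[R[i]]_(rdim (repr c))) :
  P (theta c A) = component_map (A ^+ n).
Proof.
rewrite component_mapE.
apply: (orthogonally_additive_power_mx i0 (associated_symmetric_synthesis _)).
exact: orthogonally_additive_synthesis.
Qed.

Definition canonical_map f : X := \sum_(c \in [set: dual]%classic) component_map (F c f).

Lemma component_map0 c : component_map (0 : 'M[R[i]]_(rdim (repr c))) = 0.
Proof.
pose M : {linear 'M[R[i]]_(rdim (repr c)) -> X} :=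
  HB.pack (@component_map c) (GRing.isLinear.Build _ _ _ _ _ (@component_map_is_linear c)).
exact: (linear0 M).
Qed.

Lemma canonical_map_seq f r : fourier_supported mu r f ->
  canonical_map f = \sum_(c <- r) component_map (F c f).
Proof. by apply: big_fourier_supported => c; exact: component_map0. Qed.

Lemma canonical_map_is_linear : linear canonical_map.
Proof.
move=> a f g; have [[rf sf] _] := fourier_inversion mu_inv f.
have [[rg sg] _] := fourier_inversion mu_inv g.
have [r [rfs rgs rfgs]] := joint_support sf sg.
rewrite (canonical_map_seq (rfgs a)) (canonical_map_seq rfs) (canonical_map_seq rgs).
rewrite scaler_sumr -big_split; apply: eq_bigr => c _ /=.
by rewrite linearP component_map_is_linear.
Qed.

(** Both P and the convolution power split over the blocks, where the factorization
    is that of a polynomial on matrices. *)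
Lemma canonical_map_power f : P f = canonical_map (conv_pow mu n f).
Proof.
have [[r sf] fE] := fourier_inversion mu_inv f; have [ur f0] := sf.
have spow : fourier_supported mu r (conv_pow mu n f).
  by split=> // c cr; rewrite fourier_conv_pow // f0 // expr0n eqn0Ngt n_gt0.
rewrite (canonical_map_seq spow) {1}fE.
rewrite (big_fourier_supported (fun c => theta c) _ sf) => [|c]; last exact: linear0.
rewrite orthogonally_additive_seq //; apply: eq_bigr => c _.
by rewrite fourier_conv_pow // power_component.
Qed.

(** On the block of c, Psi factors the polynomial P through the power map of
    matrices, because the convolution power of theta c A is theta c (A^n). *)
Lemma power_factorization_unique (Psi : {linear trigPoly R G -> X}) :
  (forall f, P f = Psi (conv_pow mu n f)) -> Psi =1 canonical_map.
Proof.
move=> PPsi f; have [[r sf] fE] := fourier_inversion mu_inv f.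
rewrite (canonical_map_seq sf) {1}fE.
rewrite (big_fourier_supported (fun c => theta c) _ sf) => [|c]; last exact: linear0.
rewrite linear_sum; apply: eq_bigr => c _; rewrite component_mapE.
pose Psic : {linear 'M[R[i]]_(rdim (repr c)) -> X} := Psi \o synthesis (repr c).
rewrite -[LHS]/(Psic (F c f)).
apply: (power_factorization_mx i0 (associated_symmetric_synthesis _)) => A.
rewrite PPsi /=; congr (Psi _); apply: (fourier_inj mu_inv) => c'.
rewrite fourier_conv_pow //; have [<-|cc'] := eqVneq c c'.
  by rewrite !fourier_synthesis.
by rewrite !fourier_synthesis_dual // expr0n eqn0Ngt n_gt0.
Qed.

(** The unit of the block of c is d_c chi_c, and f * d_c chi_c is the synthesis of
    the Fourier coefficient of f at c. *)
Lemma canonical_mapE f : canonical_map f = \sum_(c \in [set: dual]%classic)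
  phi (fun i : 'I_n => if i == i0 then (dual_dim c)%:R *: trig_conv mu f (dual_char c)
                       else (dual_dim c)%:R *: dual_char c).
Proof.
apply: eq_fsbigr => c _; congr phi; apply/funext => i.
by rewrite -linearZ /= -synthesis1 trig_conv_synthesis mul1mx.
Qed.

End factorization.

Local Open Scope classical_set_scope.

Theorem theorem2p3 (R : realType) (n : nat) (n_ge2 : (2 <= n)%N)
    (G : compactGroupType) (mu : probability (borel G) R)
    (mu_haar : haar_measure mu) (X : lmodType R[i])
    (P : trigPoly R G -> X) (P_hom : homogeneous_polynomial n P)
    (P_oadd : orthogonally_additive (trig_conv mu) P) :
  exists Phi : {linear trigPoly R G -> X},
    [/\ forall f, P f = Phi (conv_pow mu n f),
        forall Psi : {linear trigPoly R G -> X},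
          (forall f, P f = Psi (conv_pow mu n f)) -> Psi =1 Phi,
        forall f, finite_set
          [set c : unitary_dual R G | trig_conv mu f (dual_char c) != 0] &
        forall phi : ('I_n -> trigPoly R G) -> X,
          associated_symmetric P phi ->
          forall f, Phi f = \sum_(c \in [set: unitary_dual R G])
            phi (fun i : 'I_n =>
              if i == 0%N :> nat
              then (dual_dim c)%:R *: trig_conv mu f (dual_char c)
              else (dual_dim c)%:R *: dual_char c)].
Proof.
have [mu_inv _] := mu_haar; pose i0 : 'I_n := Ordinal (ltnW n_ge2).
have [phi Pphi] := homogeneous_symmetrization P_hom.
pose Phi : {linear trigPoly R G -> X} := HB.pack (canonical_map mu phi i0)
  (GRing.isLinear.Build _ _ _ _ _ (canonical_map_is_linear mu_inv i0 Pphi)).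
have PPhi f : P f = Phi (conv_pow mu n f) by exact: canonical_map_power.
exists Phi; split=> [//|Psi PPsi|f|psi Ppsi f].
- exact: (power_factorization_unique mu_inv i0 Pphi PPsi).
- have [[r [_ f0]] _] := fourier_inversion mu_inv f.
  apply: (sub_finite_set _ (finite_seq r)) => c /= fc.
  apply: contraNT fc => /f0 Ff0; apply/eqP.
  have d0 : (dual_dim c)%:R != 0 :> R[i] by rewrite pnatr_eq0 -lt0n rdim_gt0.
  apply: (scalerI d0); rewrite scaler0 -linearZ /= -synthesis1.
  by rewrite trig_conv_synthesis Ff0 mulmx0 linear0.
- by rewrite (power_factorization_unique mu_inv i0 Ppsi PPhi) canonical_mapE.
Qed.
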